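(* Let $0<W<1/2$ and, for odd $n$, consider on $X=[-W,W]$ the basis $$\Phi=\{\exp(2\pi ixk)\}_{k=-(n-1)/2}^{(n-1)/2}.$$ Let $k(x)=\sum_{i=1}^n|u_i(x)|^2$ be the associated inverse Christoffel function, where $\{u_i\}_{i=1}^n$ is any orthonormal basis of $\mathrm{span}(\Phi)$ in $L^2([-W,W])$. Then $$\|k\|_{L^\infty}\ge k(W)\sim n^2\,\frac\pi2\cot(W\pi)\qquad\text{as }n\to\infty.$$
   Context: $L^2([-W,W])$ is taken with respect to (unnormalized) Lebesgue measure, and $\|\cdot\|_{L^\infty}$ is the supremum norm on $[-W,W]$. The function $k$ depends on $n$ but not on the choice of the orthonormal basis $\{u_i\}$. $a_n\sim b_n$ means $a_n/b_n\to1$; the limit is over odd $n$ with $W$ fixed. *)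

(* Defs.v *)
From HB Require Import structures.
From mathcomp Require Import all_boot all_order all_algebra.
From mathcomp Require Import complex.
From mathcomp Require Import all_classical all_reals all_analysis.

Set Implicit Arguments.
Unset Strict Implicit.
Unset Printing Implicit Defensive.

Import Order.TTheory GRing.Theory Num.Theory.
Import numFieldNormedType.Exports.

Local Open Scope classical_set_scope.
Local Open Scope complex_scope.
Local Open Scope ring_scope.

Section Christoffel.
Variable R : realType.
Implicit Types (D : set R) (f g : R -> R[i]) (n : nat).

Definition cot (x : R) : R := cos x / sin x.

Definition expci (t : R) : R[i] := cos t +i* sin t.

(* For odd n, the frequency of index j runs over -(n-1)/2, ..., (n-1)/2. *)
Definition fourier n (j : 'I_n) (x : R) : R[i] :=
  expci (2 * pi * x * (j%:Z - ((n - 1)./2)%:Z)%:~R).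

(* The library integral is real-valued, so complex-valued functions are
   integrated componentwise. *)
Definition cintegral D f : R[i] :=
  (\int[lebesgue_measure]_(x in D) complex.Re (f x)) +i*
  (\int[lebesgue_measure]_(x in D) complex.Im (f x)).

Definition inner D f g : R[i] := cintegral D (fun x => f x * (g x)^*).

(* Functions on D are represented by functions on R whose values outside D
   are irrelevant, so linear combinations are only compared on D. *)
Definition fspan D n (v : 'I_n -> R -> R[i]) : set (R -> R[i]) :=
  [set f | exists c : 'I_n -> R[i],
     forall x, D x -> f x = \sum_(i < n) c i * v i x].

(* Orthonormality makes u linearly independent, so an orthonormal spanning
   family is an orthonormal basis. *)
Definition orthonormal_basis D (V : set (R -> R[i])) n
    (u : 'I_n -> R -> R[i]) : Prop :=
  (forall i j, inner D (u i) (u j) = (i == j)%:R) /\ fspan D u = V.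

Definition inv_christoffel n (u : 'I_n -> R -> R[i]) (x : R) : R :=
  \sum_(i < n) ComplexField.Normc.normc (u i x) ^+ 2.

Definition sup_norm D (f : R -> R) : \bar R :=
  ereal_sup [set `|f x|%:E | x in D].

End Christoffel.

(* Main.v *)
Require Import Defs.
From HB Require Import structures.
From mathcomp Require Import all_boot all_order all_algebra.
From mathcomp Require Import complex.
From mathcomp Require Import all_classical all_reals all_analysis.
From mathcomp Require Import ring lra zify.

Import Order.TTheory GRing.Theory Num.Theory.
Import numFieldNormedType.Exports.

(** The sum k(W) is the smallest constant with |f(W)|^2 <= k(W) ||f||^2 for all
    trigonometric polynomials f of degree at most N = (n-1)/2, so it can be
    bounded from above by proving such an inequality and from below by exhibiting
    one good f.

    Put s = sin(pi x), c = cos(pi x). The real trigonometric polynomials of degree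
    at most N are the functions P(s^2) + c s Q(s^2) with deg P <= N and
    deg Q <= N - 1, and the even part P(s^2) is orthogonal to the odd part
    c s Q(s^2) on [-W, W]. With the weight c in place of 1, the substitution
    y = s / sin(pi W) turns each part into an L^2 problem with constant weight for
    polynomials in y on [0, 1], whose endpoint y = 1 corresponds to x = W.

    That model problem has an exact answer: over combinations of the monomials
    y^l_i, the maximum of |g(1)|^2 / ||g||^2 is sum_i (2 l_i + 1), the analogue of
    the endpoint values of the Legendre kernel. Indeed the Gram matrix G, with
    entries 1 / (l_i + l_j + 1), satisfies L G + G L + G = J, where L is the
    diagonal matrix of the l_i and J the matrix of ones; multiplying by the inverse
    of G and taking traces computes the sum of the entries of the inverse of G,
    which is the maximum sought ([muntz_extremal], [muntz_cauchy_schwarz]).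

    It remains to trade the weight c for the weight 1. On [-W, W] one has
    c >= cos(pi W), with equality at the endpoint, which is what the upper bound
    needs for the odd part and the lower bound for the even part. The other two
    cases need the opposite comparison; there the polynomial is multiplied by
    (s / sin(pi W))^(2m), where the fixed m is so large that
    (s / sin(pi W))^(4m) c <= cos(pi W) on the whole interval ([sin_ratio_peak]).
    This only shifts exponents by 2m. Hence, with kappa = (pi/2) cot(pi W),

      kappa ((N+1)(2N+1) + (N-m)(2(N-m)+1))
        <= k(W) <= kappa ((N+1)(2N+1+4m) + N(2N+1)),

    and both sides are kappa (n^2 + O(n)) ([christoffel_lower],
    [christoffel_upper], [christoffel_relative_error]). *)

Set Implicit Arguments.
Unset Strict Implicit.
Unset Printing Implicit Defensive.

Local Open Scope classical_set_scope.
Local Open Scope complex_scope.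
Local Open Scope ring_scope.

(** * The extremal problem for monomials on the unit interval *)

Section MuntzGram.
Variables (F : realFieldType) (p : nat) (lam : 'I_p -> nat).
Hypothesis lam_inj : injective lam.

Definition muntz_gram : 'M[F]_p := \matrix_(i, j) ((lam i + lam j).+1%:R)^-1.

(* In the basis y^l_i, this is the operator g |-> y g'. *)
Let L : 'M[F]_p := diag_mx (\row_i (lam i)%:R).
Let one : 'rV[F]_p := const_mx 1.

(** Entrywise this is the identity
    int_0^1 y f' g + int_0^1 y f g' + int_0^1 f g = f(1) g(1) for monomials f and g,
    that is, integration of (y f g)'. *)
Lemma muntz_gram_lyapunov :
  L *m muntz_gram + muntz_gram *m L + muntz_gram = one^T *m one.
Proof.
apply/matrixP => i j.
rewrite mul_diag_mx mul_mx_diag !mxE big_ord1 !mxE mulr1.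
set d : F := (_.+1)%:R.
have d0 : d != 0 by rewrite pnatr_eq0.
transitivity (((lam i)%:R + (lam j)%:R + 1) * d^-1); first by ring.
by rewrite -natrD natr1 mulfV.
Qed.

(** Pairing the Lyapunov identity with v on both sides shows that
    the square of the sum of the entries of v vanishes; one-sided, the identity
    then shows that the kernel is stable under the diagonal matrix. *)
Lemma muntz_gram_kernel (v : 'rV[F]_p) :
  v *m muntz_gram = 0 -> v *m one^T = 0 /\ v *m L *m muntz_gram = 0.
Proof.
move=> vG.
have GvT : muntz_gram *m v^T = 0.
  rewrite -[LHS]trmxK trmx_mul trmxK.
  suff -> : muntz_gram^T = muntz_gram by rewrite vG trmx0.
  by apply/matrixP => i j; rewrite !mxE addnC.
have vJ : v *m L *m muntz_gram = v *m one^T *m one.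
  rewrite -[RHS]mulmxA -muntz_gram_lyapunov !mulmxDr !mulmxA vG mul0mx.
  by rewrite !addr0.
have v1 : v *m one^T = 0.
  have : v *m one^T *m (one *m v^T) = 0.
    by rewrite mulmxA -vJ -mulmxA GvT mulmx0.
  rewrite -[one *m v^T]trmxK trmx_mul trmxK => /matrixP/(_ 0 0).
  rewrite mxE big_ord1 [X in _ * X]mxE [RHS]mxE => /eqP; rewrite mulf_eq0 orbb.
  by move=> /eqP e; apply/matrixP => i j; rewrite !ord1 e mxE.
by split=> //; rewrite vJ v1 mul0mx.
Qed.

(** Iterating [muntz_gram_kernel], a kernel vector v satisfies
    sum_i v_i q(l_i) = 0 for every polynomial q; as the exponents are distinct, a
    Lagrange-type q isolates any single entry. *)
Lemma muntz_gram_unit : muntz_gram \in unitmx.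
Proof.
rewrite -row_free_unit -kermx_eq0; apply/eqP/row_matrixP => k; rewrite row0.
set v := row k _.
have vG : v *m muntz_gram = 0 by rewrite -row_mul mulmx_ker row0.
have sum0 (q : {poly F}) (w : 'rV[F]_p) : w *m muntz_gram = 0 ->
    \sum_i w 0 i * q.[(lam i)%:R] = 0.
  elim/poly_ind: q w => [|q c IH] w wG.
    by rewrite big1 // => i _; rewrite horner0 mulr0.
  have [w1 wLG] := muntz_gram_kernel wG.
  have := IH _ wLG; move/matrixP: w1 => /(_ 0 0); rewrite !mxE => w1 wq.
  transitivity (\sum_i (w *m L) 0 i * q.[(lam i)%:R]
                 + (\sum_i w 0 i * one^T i 0) * c).
    rewrite mulr_suml -big_split; apply: eq_bigr => i _ /=.
    by rewrite mul_mx_diag !mxE !hornerE; ring.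
  by rewrite wq w1 mul0r addr0.
apply/rowP => j; rewrite [RHS]mxE.
have := sum0 (\prod_(i | i != j) ('X - (lam i)%:R%:P)) v vG.
rewrite (bigD1 j) //= [\sum_(i | _) _]big1 => [|i ij].
  rewrite addr0 => /eqP; rewrite mulf_eq0 => /orP[/eqP //|].
  rewrite horner_prod prodf_seq_eq0 => /hasP[i _ /andP[ij]].
  rewrite !hornerE subr_eq0 eqr_nat => /eqP/lam_inj e.
  by rewrite e eqxx in ij.
apply/eqP; rewrite mulf_eq0; apply/orP; right.
by rewrite horner_prod (bigD1 i) //= !hornerE subrr mul0r.
Qed.

(** For v and w this is the inner product in L^2(0, 1) of
    sum_i v_i y^l_i and sum_j w_j y^l_j. *)
Definition muntz_form (v w : 'I_p -> F) : F :=
  \sum_i \sum_j v i * w j / (lam i + lam j).+1%:R.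

Lemma muntz_formC v w : muntz_form v w = muntz_form w v.
Proof.
rewrite /muntz_form exchange_big; apply: eq_bigr => i _; apply: eq_bigr => j _.
by rewrite addnC [v j * _]mulrC.
Qed.

Lemma muntz_form_lincombl a b u v w :
  muntz_form (fun i => a * u i + b * v i) w =
  a * muntz_form u w + b * muntz_form v w.
Proof.
rewrite /muntz_form !mulr_sumr -big_split; apply: eq_bigr => i _ /=.
rewrite !mulr_sumr -big_split; apply: eq_bigr => j _ /=.
by rewrite !mulrA -!mulrDl.
Qed.

Lemma muntz_form_lincombr a b u v w :
  muntz_form w (fun i => a * u i + b * v i) =
  a * muntz_form w u + b * muntz_form w v.
Proof. by rewrite muntz_formC muntz_form_lincombl !(muntz_formC w). Qed.

Definition muntz_trace : F := \sum_i (2 * lam i + 1)%:R.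

(** The vector a holds the coefficients of the reproducing kernel at
    y = 1, namely the inverse Gram matrix applied to the vector of ones. Its value at
    1 is the trace of (inverse of G) J, and replacing J by L G + G L + G
    turns this trace into 2 tr L + p. *)
Lemma muntz_extremal : exists a : 'I_p -> F,
  (forall v, muntz_form v a = \sum_i v i) /\ \sum_i a i = muntz_trace.
Proof.
pose a := one *m invmx muntz_gram.
have aG : a *m muntz_gram = one by rewrite mulmxKV //; exact: muntz_gram_unit.
exists (fun i => a 0 i); split.
  move=> v; apply: eq_bigr => j _.
  transitivity (v j * one 0 j); last by rewrite mxE mulr1.
  rewrite -aG mxE mulr_sumr; apply: eq_bigr => i _.
  by rewrite [muntz_gram _ _]mxE -mulrA addnC.
transitivity (\tr (a *m one^T)).
  rewrite /mxtrace big_ord1 mxE; apply: eq_bigr => i _.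
  by have -> : one^T i 0 = 1; rewrite ?mulr1 // !mxE.
rewrite mxtrace_mulC mulmxA -muntz_gram_lyapunov !mulmxDl !mxtraceD.
rewrite [X in _ + X + _]mxtrace_mulC mulmxA.
rewrite mulmxK ?muntz_gram_unit // mulVmx ?muntz_gram_unit // mul1mx.
rewrite mulmxV ?muntz_gram_unit // mxtrace1 mxtrace_diag -[p in p%:R]card_ord.
rewrite -sum1_card natr_sum -!big_split; apply: eq_bigr => i _ /=.
by rewrite mxE -!natrD mul2n -addnn.
Qed.

Lemma muntz_trace_ge0 : 0 <= muntz_trace.
Proof. by apply: sumr_ge0 => i _; rewrite ler0n. Qed.

(** Cauchy-Schwarz against the reproducing kernel of
    [muntz_extremal]: the value at 1 is an inner product with the kernel, whose
    square norm is the trace. *)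
Lemma muntz_cauchy_schwarz v : (forall w, 0 <= muntz_form w w) ->
  (\sum_i v i) ^+ 2 <= muntz_trace * muntz_form v v.
Proof.
move=> form_ge0; have [a [av sa]] := muntz_extremal.
have := muntz_trace_ge0; rewrite le_eqVlt => /orP[/eqP S0|S_gt0].
  suff -> : \sum_i v i = 0 by rewrite -S0 mul0r expr0n.
  rewrite big1 // => i _; move/eqP: S0.
  rewrite eq_sym psumr_eq0 => [/allP/(_ i)|j _]; last by rewrite ler0n.
  by rewrite mem_index_enum pnatr_eq0 addn1 => /(_ isT).
set S := muntz_trace in S_gt0 sa *; set t := \sum_i v i.
have := form_ge0 (fun i => S * v i + (- t) * a i).
rewrite muntz_form_lincombl !muntz_form_lincombr.
rewrite [muntz_form a v]muntz_formC !av sa -/t => Q0.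
rewrite -(ler_pM2l S_gt0) -subr_ge0; move: Q0.
by congr (0 <= _); ring.
Qed.

End MuntzGram.

(** * Integrals of continuous functions over [-W, W] *)

Section SineMoments.
Variables (R : realType) (W : R).
Hypothesis W_gt0 : 0 < W.

Local Notation mu := (@lebesgue_measure R).
Local Notation D := (`[- W, W]%classic).
Local Notation s x := (sin (x * pi)).
Local Notation c x := (cos (x * pi)).

Lemma continuous_integrable (f : R -> R) :
  continuous f -> mu.-integrable D (EFin \o f).
Proof.
move=> cf; apply: continuous_compact_integrable; first exact: segment_compact.
exact: continuous_subspaceT.
Qed.

Lemma continuous_mul (f g : R -> R) :
  continuous f -> continuous g -> continuous (fun x => f x * g x).
Proof. by move=> cf cg x; exact: (continuousM (cf x) (cg x)). Qed.

Lemma continuous_add (f g : R -> R) :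
  continuous f -> continuous g -> continuous (fun x => f x + g x).
Proof. by move=> cf cg x; exact: (continuousD (cf x) (cg x)). Qed.

Lemma continuous_sum (I : Type) (r : seq I) (f : I -> R -> R) :
  (forall i, continuous (f i)) -> continuous (fun x => \sum_(i <- r) f i x).
Proof.
move=> cf; elim: r => [|i r IH] x.
  rewrite (_ : (fun x => _) = cst 0); first exact: cst_continuous.
  by apply/funext => y; rewrite big_nil.
rewrite (_ : (fun x => _) = f i \+ (fun x => \sum_(i <- r) f i x)).
  by apply: continuousD; [exact: cf|exact: IH].
by apply/funext => y; rewrite big_cons.
Qed.

Lemma Rintegral_sum (I : Type) (r : seq I) (a : I -> R) (f : I -> R -> R) :
  (forall i, continuous (f i)) ->
  \int[mu]_(x in D) (\sum_(i <- r) a i * f i x) =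
  \sum_(i <- r) a i * \int[mu]_(x in D) f i x.
Proof.
move=> cf.
have caf i : continuous (fun x => a i * f i x).
  by apply: continuous_mul => //; exact: cst_continuous.
elim: r => [|i r IH].
  rewrite big_nil; under eq_Rintegral do rewrite big_nil.
  by rewrite Rintegral_cst //= mul0r.
rewrite big_cons -IH; under eq_Rintegral do rewrite big_cons.
rewrite RintegralD //.
- by rewrite RintegralZl //; exact: continuous_integrable.
- exact: continuous_integrable.
- exact/continuous_integrable/continuous_sum.
Qed.

Lemma le_continuous_Rintegral (f g : R -> R) : continuous f -> continuous g ->
  (forall x, D x -> f x <= g x) ->
  \int[mu]_(x in D) f x <= \int[mu]_(x in D) g x.
Proof.
move=> cf cg fg; apply: (@le_Rintegral _ _ _ mu D f g _ _ _ fg); first by [].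
  exact: continuous_integrable.
exact: continuous_integrable.
Qed.

Lemma Rintegral_antiderivative (F f : R -> R) :
  (forall x : R, is_derive x (1 : R) F (f x)) -> continuous f ->
  \int[mu]_(x in D) f x = F W - F (- W).
Proof.
move=> dF cf.
have cF x : {for x, continuous F}.
  by apply: differentiable_continuous; apply/derivable1_diffP; exact: ex_derive.
rewrite /Rintegral (@continuous_FTC2 _ f F) //.
- by rewrite gtrN.
- exact: continuous_subspaceT.
- split=> [x _| |]; first exact: ex_derive.
    by apply: cvg_at_right_filter; exact: cF.
  by apply: cvg_at_left_filter; exact: cF.
- by move=> x _; rewrite derive1E derive_val.
Qed.

Lemma continuous_sin_pi : continuous (fun x : R => s x).
Proof.
move=> x; apply: (@continuous_comp R R R ( *%R^~ pi) sin).
  exact: mulrr_continuous.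
exact: continuous_sin.
Qed.

Lemma continuous_cos_pi : continuous (fun x : R => c x).
Proof.
move=> x; apply: (@continuous_comp R R R ( *%R^~ pi) cos).
  exact: mulrr_continuous.
exact: continuous_cos.
Qed.

Lemma continuousX (f : R -> R) n : continuous f -> continuous (fun x => f x ^+ n).
Proof.
move=> cf x; apply: (@continuous_comp R R R f (@GRing.exp R ^~ n)).
  exact: cf.
exact: exprn_continuous.
Qed.

(** The factor cos makes the integrand an exact derivative, which is
    why the weight cos is used throughout. *)
Lemma Rintegral_sinX_cos l :
  \int[mu]_(x in D) (s x ^+ l * c x) =
  (s W ^+ l.+1 - (- s W) ^+ l.+1) / (pi * l.+1%:R).
Proof.
have pi0 : (pi : R) != 0 by rewrite gt_eqF // pi_gt0.
have l0 : l.+1%:R != 0 :> R by rewrite pnatr_eq0.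
pose F (x : R) := (pi * l.+1%:R)^-1 * s x ^+ l.+1.
have dF (x : R) : is_derive x (1 : R) F (s x ^+ l * c x).
  have ds : is_derive x (1 : R) (fun x : R => s x) (c x * pi).
    apply: (@is_derive1_comp _ sin ( *%R^~ pi)).
    have -> : *%R^~ pi = pi \*: (@idfun R).
      by apply/funext => y; rewrite mulrC.
    by apply: is_derive_eq; rewrite /GRing.scale /= mulr1.
  have -> : F = (pi * l.+1%:R)^-1 \*: ((fun x : R => s x) ^+ l.+1).
    by apply/funext => y; rewrite /F exprfctE.
  apply: is_derive_eq; rewrite /GRing.scale /= invfM.
  by rewrite [c x * pi]mulrC !mulrA mulfVK // [pi^-1 * _]mulrC mulfVK.
rewrite (Rintegral_antiderivative dF) /F.
  by rewrite mulNr sinN; ring.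
apply: continuous_mul; last exact: continuous_cos_pi.
exact/continuousX/continuous_sin_pi.
Qed.

End SineMoments.

(** * The weight cos(pi x) on [-W, W] *)

(** A form of Bernoulli's inequality: z^-k >= 1 + k (1 - z). *)
Lemma exprn_onem_le1 (F : realFieldType) (z : F) k :
  0 <= z <= 1 -> z ^+ k * (1 + k%:R * (1 - z)) <= 1.
Proof.
move=> /andP[z0 z1]; elim: k => [|k IH]; first by rewrite expr0; lra.
have zk : z ^+ k.+1 <= 1 by rewrite exprn_ile1.
apply: (@le_trans _ _ (z * 1 + z ^+ k.+1 * (1 - z))); last first.
  by have := ler_wpM2r (_ : 0 <= 1 - z) zk; rewrite subr_ge0 => /(_ z1); lra.
rewrite [leLHS](_ : _ = z * (z ^+ k * (1 + k%:R * (1 - z))) + z ^+ k.+1 * (1 - z)).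
  by rewrite lerD2r ler_wpM2l.
by rewrite -natr1 exprS; ring.
Qed.

Section ArcTrigonometry.
Variables (R : realType) (W : R).
Hypotheses (W_gt0 : 0 < W) (W_lt : W < 1 / 2).

Local Notation D := (`[- W, W]%classic).
Local Notation s x := (sin (x * pi)).
Local Notation c x := (cos (x * pi)).

Lemma Wpi_bounds : 0 < W * pi < pi / 2.
Proof.
have := @pi_gt0 R => pi0.
by rewrite mulr_gt0 //= mulrC ltr_pM2l //; move: W_lt; lra.
Qed.

Lemma sinW_gt0 : 0 < s W. Proof. exact: sin_gt0_pihalf Wpi_bounds. Qed.

Lemma cosW_gt0 : 0 < c W.
Proof.
apply: cos_gt0_pihalf; have /andP[h0 ->] := Wpi_bounds; rewrite andbT.
by rewrite (lt_trans _ h0) // oppr_lt0 divr_gt0 ?pi_gt0.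
Qed.

Lemma cosW_le x : D x -> c W <= c x.
Proof.
rewrite /= in_itv /= -ler_norml => xW.
have p0 := @pi_gt0 R; have /andP[h0 h1] := Wpi_bounds.
have xp : `|x * pi| <= W * pi by rewrite normrM (gtr0_norm p0) ler_pM2r.
have Wp : W * pi <= pi by rewrite (le_trans (ltW h1)) // ler_pdivrMr //; lra.
have xin : `|x * pi| \in `[0, pi] by rewrite in_itv /= normr_ge0 (le_trans xp).
have Win : W * pi \in `[0, pi] by rewrite in_itv /= ltW.
by rewrite -(cos_norm (x * pi)) leNgt ltr_cos // -leNgt.
Qed.

Lemma sin_ratio_itv x : D x -> 0 <= (s x / s W) ^+ 2 <= 1.
Proof.
move=> Dx; rewrite sqr_ge0 /= expr_div_n ler_pdivrMr ?exprn_gt0 ?sinW_gt0 //.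
rewrite mul1r !sin2cos2 lerD2l lerN2 ler_pXn2r ?nnegrE ?(ltW cosW_gt0) //.
  exact: cosW_le.
exact: le_trans (ltW cosW_gt0) (cosW_le Dx).
Qed.

(** With Z = (s / sin(pi W))^2 and t = tan(pi W)^2, the square of the
    claim reads Z^(4m) (1 + t (1 - Z)) <= 1, because
    c^2 = cos(pi W)^2 (1 + t (1 - Z)); so m >= t is large enough. *)
Lemma sin_ratio_peak : exists m, forall x, D x ->
  (s x / s W) ^+ (4 * m) * c x <= c W.
Proof.
have cW := cosW_gt0; have sW := sinW_gt0.
pose t := (s W / c W) ^+ 2.
have [m tm] : exists m, t <= m%:R.
  by exists (Num.truncn t).+1; rewrite ltW // truncnS_gt.
exists m => x Dx.
have cx : 0 <= c x by exact: le_trans (ltW cW) (cosW_le Dx).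
have Z01 := sin_ratio_itv Dx; set Z := (_ / _) ^+ 2 in Z01.
have -> : (s x / s W) ^+ (4 * m) = Z ^+ (2 * m).
  by rewrite /Z -exprM mulnA.
have Z0 : 0 <= Z ^+ (2 * m) by apply: exprn_ge0; case/andP: Z01.
rewrite -(@ler_pXn2r _ 2) ?nnegrE ?mulr_ge0 ?(ltW cW) //.
rewrite exprMn -exprM.
have -> : c x ^+ 2 = c W ^+ 2 * (1 + t * (1 - Z)).
  rewrite cos2sin2 /t /Z !expr_div_n.
  have a0 : s W ^+ 2 != 0 by rewrite expf_eq0 gt_eqF.
  have b0 : c W ^+ 2 != 0 by rewrite expf_eq0 gt_eqF.
  have := cos2Dsin2 (W * pi); move: (s W ^+ 2) (c W ^+ 2) (s x ^+ 2) a0 b0.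
  by move=> a b y a0 b0 ab; rewrite -{1}ab; field; rewrite a0 b0.
rewrite mulrCA ger_pMr ?exprn_gt0 //.
apply: le_trans (@exprn_onem_le1 _ Z (2 * m * 2) Z01).
have /andP[Z_ge0 Z_le1] := Z01.
apply: ler_wpM2l; first exact: exprn_ge0.
rewrite lerD2l; apply: ler_wpM2r; first by rewrite subr_ge0.
by rewrite (le_trans tm) // ler_nat; lia.
Qed.

End ArcTrigonometry.

(** * Muntz polynomials in sin(pi x) / sin(pi W) *)

(** Exponents in progressions of step 2: the corresponding functions
    have a definite parity. *)
Definition arith_step r p (i : 'I_p) : nat := (2 * i + r)%N.

Lemma arith_step_inj r p : injective (@arith_step r p).
Proof. by move=> i j /eqP; rewrite eqn_add2r eqn_pmul2l // => /eqP/val_inj. Qed.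

Lemma arith_step_parity r p (i j : 'I_p) : ~~ odd (arith_step r i + arith_step r j)%N.
Proof.
have -> : (arith_step r i + arith_step r j = (i + j + r).*2)%N.
  by rewrite /arith_step; lia.
by rewrite odd_double.
Qed.

Lemma arith_step_trace (R : realFieldType) r p :
  muntz_trace R (@arith_step r p) = p%:R * (2 * p%:R + 2 * r%:R - 1).
Proof.
rewrite /muntz_trace /arith_step.
elim: p => [|p IH]; first by rewrite big_ord0 mul0r.
rewrite big_ord_recr [in LHS]/= IH -natr1 !(natrD, natrM); ring.
Qed.

Section MuntzFun.
Variables (R : realType) (W : R).
Hypotheses (W_gt0 : 0 < W) (W_lt : W < 1 / 2).

Local Notation mu := (@lebesgue_measure R).
Local Notation D := (`[- W, W]%classic).
Local Notation s x := (sin (x * pi)).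
Local Notation c x := (cos (x * pi)).

(** The Muntz polynomial with coefficients v in the variable
    y = sin(pi x) / sin(pi W). *)
Definition muntz_fun p (lam : 'I_p -> nat) (v : 'I_p -> R) (x : R) : R :=
  \sum_i v i * (s x / s W) ^+ lam i.

(** This is (pi/2) cot(pi W). *)
Definition endpoint_rate : R := pi * c W / (2 * s W).

Lemma endpoint_rate_gt0 : 0 < endpoint_rate.
Proof.
by rewrite divr_gt0 ?mulr_gt0 ?pi_gt0 ?cosW_gt0 ?sinW_gt0.
Qed.

Lemma continuous_ratioX l : continuous (fun x : R => (s x / s W) ^+ l).
Proof.
apply: continuousX; apply: continuous_mul; first exact: continuous_sin_pi.
exact: cst_continuous.
Qed.

Lemma continuous_muntz_fun p (lam : 'I_p -> nat) v :
  continuous (muntz_fun lam v).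
Proof.
apply: continuous_sum => i; apply: continuous_mul; first exact: cst_continuous.
exact: continuous_ratioX.
Qed.

Lemma muntz_fun_end p (lam : 'I_p -> nat) v : muntz_fun lam v W = \sum_i v i.
Proof.
apply: eq_bigr => i _.
by rewrite divff ?expr1n ?mulr1 // gt_eqF // sinW_gt0.
Qed.

(** Odd powers cancel by symmetry; even ones give twice the moment
    of y^l on [0, 1], up to the Jacobian sin(pi W) / pi. *)
Lemma Rintegral_ratioX_cos l :
  \int[mu]_(x in D) ((s x / s W) ^+ l * c x) =
  if odd l then 0 else 2 * s W / pi / l.+1%:R.
Proof.
have sW : s W != 0 by rewrite gt_eqF // sinW_gt0.
have cl : continuous (fun x : R => s x ^+ l * c x).
  apply: continuous_mul; last exact: continuous_cos_pi.
  exact/continuousX/continuous_sin_pi.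
under eq_Rintegral do rewrite expr_div_n mulrAC mulrC.
rewrite RintegralZl //; last exact: continuous_integrable.
rewrite Rintegral_sinX_cos // exprNn -signr_odd /=.
case: (odd l) => /=; first by rewrite expr0 mul1r subrr mul0r mulr0.
rewrite expr1 mulN1r opprK invfM exprS !mulrA -mulrDl; congr (_ * _ * _).
rewrite mulrC -mulrA mulfV ?expf_neq0 //; ring.
Qed.

Lemma Rintegral_muntz_fun p q (lam : 'I_p -> nat) (nu : 'I_q -> nat) v w :
  \int[mu]_(x in D) (muntz_fun lam v x * muntz_fun nu w x * c x) =
  \sum_i \sum_j v i * w j *
    (if odd (lam i + nu j)%N then 0 else 2 * s W / pi / (lam i + nu j).+1%:R).
Proof.
have cc l : continuous (fun x : R => (s x / s W) ^+ l * c x).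
  by apply: continuous_mul; [exact: continuous_ratioX|exact: continuous_cos_pi].
transitivity (\int[mu]_(x in D) (\sum_i v i *
    (\sum_j w j * ((s x / s W) ^+ (lam i + nu j)%N * c x)))).
  apply: eq_Rintegral => x _; rewrite -mulrA mulr_suml.
  apply: eq_bigr => i _; rewrite -mulrA; congr (_ * _).
  rewrite mulr_suml mulr_sumr; apply: eq_bigr => j _.
  by rewrite exprD; ring.
rewrite Rintegral_sum => [|i]; last first.
  by apply: continuous_sum => j; apply: continuous_mul => //; exact: cst_continuous.
apply: eq_bigr => i _; rewrite Rintegral_sum // mulr_sumr; apply: eq_bigr => j _.
by rewrite Rintegral_ratioX_cos mulrA.
Qed.

Lemma Rintegral_muntz_form p (lam : 'I_p -> nat) v w :
  (forall i j, ~~ odd (lam i + lam j)%N) ->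
  \int[mu]_(x in D) (muntz_fun lam v x * muntz_fun lam w x * c x) =
  2 * s W / pi * muntz_form (F := R) lam v w.
Proof.
move=> par; rewrite Rintegral_muntz_fun /muntz_form !mulr_sumr.
apply: eq_bigr => i _; rewrite mulr_sumr; apply: eq_bigr => j _.
by rewrite (negbTE (par i j)); ring.
Qed.

Lemma Rintegral_muntz_orthogonal p q (lam : 'I_p -> nat) (nu : 'I_q -> nat) v w :
  (forall i j, odd (lam i + nu j)%N) ->
  \int[mu]_(x in D) (muntz_fun lam v x * muntz_fun nu w x * c x) = 0.
Proof.
move=> par; rewrite Rintegral_muntz_fun big1 // => i _; rewrite big1 // => j _.
by rewrite par mulr0.
Qed.

(** The form is a positive multiple of the integral of a square against the
    weight cos(pi x). *)
Lemma muntz_form_ge0 p (lam : 'I_p -> nat) v :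
  (forall i j, ~~ odd (lam i + lam j)%N) -> 0 <= muntz_form (F := R) lam v v.
Proof.
move=> par; have k0 : 0 < 2 * s W / pi.
  by rewrite divr_gt0 ?mulr_gt0 ?pi_gt0 ?sinW_gt0.
rewrite -(pmulr_rge0 _ k0) -Rintegral_muntz_form //.
apply: Rintegral_ge0 => x Dx; rewrite -expr2 mulr_ge0 ?sqr_ge0 //.
by rewrite (le_trans (ltW (cosW_gt0 W_gt0 W_lt))) // cosW_le.
Qed.

Lemma muntz_fun_end_le p (lam : 'I_p -> nat) v :
  injective lam -> (forall i j, ~~ odd (lam i + lam j)%N) ->
  c W * (\sum_i v i) ^+ 2 <= endpoint_rate * muntz_trace R lam *
    \int[mu]_(x in D) (muntz_fun lam v x ^+ 2 * c x).
Proof.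
move=> inj par.
under eq_Rintegral do rewrite expr2.
rewrite Rintegral_muntz_form // /endpoint_rate.
have := @muntz_cauchy_schwarz R p lam inj v (fun w => muntz_form_ge0 w par).
rewrite -(ler_pM2l (cosW_gt0 W_gt0 W_lt)) => /le_trans; apply.
have sW : s W != 0 by rewrite gt_eqF // sinW_gt0.
have pi0 : pi != 0 :> R by rewrite gt_eqF // pi_gt0.
rewrite le_eqVlt; apply/orP; left; apply/eqP.
move: (s W) (c W) (pi : R) sW pi0 => S C p0 S0 P0.
by field; rewrite S0 P0.
Qed.

End MuntzFun.

(** * Endpoint bounds for the unweighted norm *)

Lemma sqrD_le_mulD (F : realFieldType) (x y A B X Y : F) :
  0 <= A -> 0 <= B -> 0 <= X -> 0 <= Y -> x ^+ 2 <= A * X -> y ^+ 2 <= B * Y ->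
  (x + y) ^+ 2 <= (A + B) * (X + Y).
Proof.
move=> A0 B0 X0 Y0 xAX yBY.
have AY0 : 0 <= A * Y by rewrite mulr_ge0.
have BX0 : 0 <= B * X by rewrite mulr_ge0.
suff xy : x * y *+ 2 <= A * Y + B * X.
  by rewrite sqrrD mulrDl !mulrDr; lra.
rewrite (le_trans (ler_norm _)) // -(@ler_pXn2r _ 2) ?nnegrE ?addr_ge0 //.
rewrite real_normK ?num_real //.
have : x ^+ 2 * y ^+ 2 <= (A * X) * (B * Y) by rewrite ler_pM ?sqr_ge0.
have := sqr_ge0 (A * Y - B * X).
rewrite -mulr_natr; nra.
Qed.

Section ArcSandwich.
Variables (R : realType) (W : R).
Hypotheses (W_gt0 : 0 < W) (W_lt : W < 1 / 2).

Local Notation mu := (@lebesgue_measure R).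
Local Notation D := (`[- W, W]%classic).
Local Notation s x := (sin (x * pi)).
Local Notation c x := (cos (x * pi)).
Local Notation kappa := (endpoint_rate W).
Local Notation tr r p := (muntz_trace R (@arith_step r p)).

(** A trigonometric polynomial, even part plus odd part, in the variable
    sin(pi x) / sin(pi W): the two starting exponents re and ro are kept free so that
    either part can carry an extra factor (sin(pi x) / sin(pi W))^(2m). *)
Definition arc_fun p q re ro (v : 'I_p -> R) (w : 'I_q -> R) (x : R) : R :=
  muntz_fun W (@arith_step re p) v x + c x * muntz_fun W (@arith_step ro q) w x.

Lemma continuous_arc_fun p q re ro (v : 'I_p -> R) (w : 'I_q -> R) :
  continuous (arc_fun re ro v w).
Proof.
apply: continuous_add; first exact: continuous_muntz_fun.
by apply: continuous_mul; [exact: continuous_cos_pi|exact: continuous_muntz_fun].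
Qed.

Lemma arc_fun_end p q re ro (v : 'I_p -> R) (w : 'I_q -> R) :
  arc_fun re ro v w W = \sum_i v i + c W * \sum_i w i.
Proof. by rewrite /arc_fun !muntz_fun_end. Qed.

(** The cross term is a combination of odd powers of sin(pi x), times cos(pi x). *)
Lemma Rintegral_arc_fun_sqr p q re ro (v : 'I_p -> R) (w : 'I_q -> R) :
  odd (re + ro)%N ->
  \int[mu]_(x in D) (arc_fun re ro v w x ^+ 2) =
  \int[mu]_(x in D) (muntz_fun W (@arith_step re p) v x ^+ 2) +
  \int[mu]_(x in D) ((c x * muntz_fun W (@arith_step ro q) w x) ^+ 2).
Proof.
move=> par; set E := muntz_fun W _ v; set O := muntz_fun W _ w.
have cE : continuous E by exact: continuous_muntz_fun.
have cO : continuous O by exact: continuous_muntz_fun.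
have cc := @continuous_cos_pi R.
have cEO : continuous (fun x : R => E x * O x * c x).
  by apply: continuous_mul => //; exact: continuous_mul.
have cE2 : continuous (fun x : R => E x ^+ 2) by exact: continuousX.
have cO2 : continuous (fun x : R => (c x * O x) ^+ 2).
  by apply: continuousX; exact: continuous_mul.
transitivity (\int[mu]_(x in D)
    ((E x ^+ 2 + (c x * O x) ^+ 2) + 2 * (E x * O x * c x))).
  by apply: eq_Rintegral => x _; rewrite /arc_fun -/E -/O; ring.
rewrite RintegralD //; last 2 first.
- by apply: continuous_integrable; exact: continuous_add.
- apply: continuous_integrable; apply: continuous_mul => //.
  exact: cst_continuous.
rewrite RintegralZl //; last exact: continuous_integrable.
rewrite Rintegral_muntz_orthogonal // => [|i j]; last first.
  have -> : (arith_step re i + arith_step ro j = (i + j).*2 + (re + ro))%N.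
    by rewrite /arith_step; lia.
  by rewrite oddD odd_double par.
by rewrite mulr0 addr0 RintegralD //; exact: continuous_integrable.
Qed.

(** Here c >= cos(pi W) points the wrong way, so the bound for the
    weight c is applied to the product with (s / sin(pi W))^(2m), which has the same
    value at W. *)
Lemma even_part_end_le m p (v : 'I_p -> R) :
  (forall x, D x -> (s x / s W) ^+ (4 * m) * c x <= c W) ->
  (\sum_i v i) ^+ 2 <= kappa * tr (2 * m)%N p *
    \int[mu]_(x in D) (muntz_fun W (@arith_step 0%N p) v x ^+ 2).
Proof.
move=> peak; have cW := cosW_gt0 W_gt0 W_lt.
have cE r : continuous (muntz_fun W (@arith_step r p) v).
  exact: continuous_muntz_fun.
rewrite -(ler_pM2l cW); apply: le_trans.
  exact: (muntz_fun_end_le W_gt0 W_lt v (@arith_step_inj (2 * m)%N p)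
            (@arith_step_parity (2 * m)%N p)).
rewrite mulrCA; apply: ler_wpM2l.
  rewrite mulr_ge0 ?muntz_trace_ge0 // ltW //; exact: endpoint_rate_gt0.
rewrite -RintegralZl //; last by apply: continuous_integrable; exact: continuousX.
apply: le_continuous_Rintegral.
- apply: continuous_mul; [exact: continuousX|exact: continuous_cos_pi].
- apply: continuous_mul; [exact: cst_continuous|exact: continuousX].
move=> x Dx; set E := muntz_fun W (@arith_step 0%N p) v x.
have -> : muntz_fun W (@arith_step (2 * m)%N p) v x = (s x / s W) ^+ (2 * m) * E.
  rewrite mulr_sumr; apply: eq_bigr => i _.
  by rewrite /arith_step addn0 exprD; ring.
rewrite exprMn -exprM mulrAC; apply: ler_wpM2r; first exact: sqr_ge0.
by rewrite (_ : 2 * m * 2 = 4 * m)%N ?peak //; lia.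
Qed.

(** The square of the odd part carries c^2 = c . c, and one factor is
    bounded below by cos(pi W). *)
Lemma odd_part_end_le p (w : 'I_p -> R) :
  (c W * \sum_i w i) ^+ 2 <= kappa * tr 1%N p *
    \int[mu]_(x in D) ((c x * muntz_fun W (@arith_step 1%N p) w x) ^+ 2).
Proof.
have cW := cosW_gt0 W_gt0 W_lt.
have cE : continuous (muntz_fun W (@arith_step 1%N p) w).
  exact: continuous_muntz_fun.
have cc := @continuous_cos_pi R.
rewrite exprMn [c W ^+ 2]expr2.
apply: (@le_trans _ _ (c W * (kappa * tr 1%N p *
    \int[mu]_(x in D) (muntz_fun W (@arith_step 1%N p) w x ^+ 2 * c x)))).
  rewrite -[leLHS]mulrA ler_pM2l //.
  exact: (muntz_fun_end_le W_gt0 W_lt w (@arith_step_inj 1%N p)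
            (@arith_step_parity 1%N p)).
rewrite mulrCA; apply: ler_wpM2l.
  rewrite mulr_ge0 ?muntz_trace_ge0 // ltW //; exact: endpoint_rate_gt0.
have cE2 : continuous (fun x : R => muntz_fun W (@arith_step 1%N p) w x ^+ 2 * c x).
  by apply: continuous_mul => //; exact: continuousX.
rewrite -RintegralZl //; last exact: continuous_integrable.
apply: le_continuous_Rintegral.
- by apply: continuous_mul => //; exact: cst_continuous.
- by apply: continuousX; exact: continuous_mul.
move=> x Dx; rewrite mulrCA exprMn [leRHS]mulrC.
apply: ler_wpM2l; first exact: sqr_ge0.
rewrite expr2; apply: ler_wpM2r; last exact: cosW_le.
exact: le_trans (ltW cW) (cosW_le W_gt0 W_lt Dx).
Qed.

Lemma arc_fun_end_le m p q (v : 'I_p -> R) (w : 'I_q -> R) :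
  (forall x, D x -> (s x / s W) ^+ (4 * m) * c x <= c W) ->
  arc_fun 0%N 1%N v w W ^+ 2 <= kappa * (tr (2 * m)%N p + tr 1%N q) *
    \int[mu]_(x in D) (arc_fun 0%N 1%N v w x ^+ 2).
Proof.
move=> peak; rewrite arc_fun_end Rintegral_arc_fun_sqr // [kappa * _]mulrDr.
have k0 : 0 <= kappa by rewrite ltW //; exact: endpoint_rate_gt0.
apply: sqrD_le_mulD; rewrite ?(mulr_ge0 k0) ?muntz_trace_ge0 //.
- by apply: Rintegral_ge0 => x _; exact: sqr_ge0.
- by apply: Rintegral_ge0 => x _; exact: sqr_ge0.
- exact: even_part_end_le.
- exact: odd_part_end_le.
Qed.

(** The roles of the two parities are exchanged with respect to
    [even_part_end_le] and [odd_part_end_le]: the even extremal polynomial is used as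
    it is, and the odd one is damped by (s / sin(pi W))^(2m). The factor 1 / cos(pi W)
    is the scale at which kappa times the square norm is bounded by the value at W for
    each part separately, so that the two estimates add up. *)
Lemma arc_fun_extremal m p q :
  (forall x, D x -> (s x / s W) ^+ (4 * m) * c x <= c W) ->
  exists (v : 'I_p -> R) (w : 'I_q -> R),
    arc_fun 0%N (2 * m + 1)%N v w W = tr 0%N p + tr 1%N q /\
    kappa * \int[mu]_(x in D) (arc_fun 0%N (2 * m + 1)%N v w x ^+ 2)
      <= tr 0%N p + tr 1%N q.
Proof.
move=> peak; have cW := cosW_gt0 W_gt0 W_lt.
have sW := sinW_gt0 W_gt0 W_lt.
have [a [aE aS]] := @muntz_extremal R p _ (@arith_step_inj 0 p).
have [b [bE bS]] := @muntz_extremal R q _ (@arith_step_inj 1 q).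
pose w i := (c W)^-1 * b i.
exists a, w; split.
  by rewrite arc_fun_end aS -mulr_sumr mulrA mulfV ?mul1r ?bS // gt_eqF.
have cE r k (v : 'I_k -> R) : continuous (muntz_fun W (@arith_step r k) v).
  exact: continuous_muntz_fun.
have cc := @continuous_cos_pi R.
have par : odd (0 + (2 * m + 1))%N by rewrite add0n addn1 mul2n /= odd_double.
rewrite (Rintegral_arc_fun_sqr _ _ par).
have norm_c k r (v : 'I_k -> R) :
    \int[mu]_(x in D) (muntz_fun W (@arith_step r k) v x ^+ 2 * c x) =
    2 * s W / pi * muntz_form (@arith_step r k) v v.
  under eq_Rintegral do rewrite expr2.
  by rewrite Rintegral_muntz_form //; exact: arith_step_parity.
have cE2c r k (v : 'I_k -> R) :
    continuous (fun x : R => muntz_fun W (@arith_step r k) v x ^+ 2 * c x).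
  by apply: continuous_mul => //; exact: continuousX.
have E_le : c W * \int[mu]_(x in D) (muntz_fun W (@arith_step 0%N p) a x ^+ 2)
    <= 2 * s W / pi * tr 0%N p.
  rewrite -aS -(aE a) -norm_c -RintegralZl //; last first.
    by apply: continuous_integrable; exact: continuousX.
  apply: le_continuous_Rintegral => //.
    by apply: continuous_mul; [exact: cst_continuous|exact: continuousX].
  move=> x Dx; rewrite mulrC; apply: ler_wpM2l; first exact: sqr_ge0.
  exact: cosW_le.
have O_le : c W * \int[mu]_(x in D)
      ((c x * muntz_fun W (@arith_step (2 * m + 1)%N q) w x) ^+ 2)
    <= 2 * s W / pi * tr 1%N q.
  rewrite -bS -(bE b) -norm_c -RintegralZl //; last first.
    by apply: continuous_integrable; apply: continuousX; exact: continuous_mul.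
  apply: le_continuous_Rintegral => //.
    apply: continuous_mul; first exact: cst_continuous.
    by apply: continuousX; exact: continuous_mul.
  move=> x Dx; set O := muntz_fun W (@arith_step 1%N q) b x.
  have -> : muntz_fun W (@arith_step (2 * m + 1)%N q) w x =
      (c W)^-1 * ((s x / s W) ^+ (2 * m) * O).
    rewrite mulrCA !mulr_sumr; apply: eq_bigr => i _.
    by rewrite /arith_step /w addnCA exprD; ring.
  have cx : 0 <= c x by exact: le_trans (ltW cW) (cosW_le W_gt0 W_lt Dx).
  rewrite -(ler_pM2l cW).
  have -> : c W * (c W * (c x * ((c W)^-1 * ((s x / s W) ^+ (2 * m) * O))) ^+ 2)
      = (s x / s W) ^+ (4 * m) * c x * (O ^+ 2 * c x).
    rewrite (_ : 4 * m = 2 * m * 2)%N; last by lia.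
    rewrite [X in _ = X * _ * _]exprM.
    move: (c W) cW (c x) O ((s x / s W) ^+ (2 * m)).
    by move=> C /gt_eqF C0 y O z; field; rewrite C0.
  apply: ler_wpM2r; last exact: peak.
  by rewrite mulr_ge0 ?sqr_ge0.
have pi0 := @pi_gt0 R.
rewrite /endpoint_rate -(ler_pM2l (_ : 0 < 2 * s W / pi)); last first.
  by rewrite divr_gt0 ?mulr_gt0.
apply: le_trans (_ : _ <= 2 * s W / pi * tr 0%N p + 2 * s W / pi * tr 1%N q) _.
  apply: le_trans (lerD E_le O_le); rewrite -mulrDr.
  move: (_ + _) => X; rewrite le_eqVlt; apply/orP; left; apply/eqP.
  move: (c W) (s W) (pi : R) sW pi0 => C S P /gt_eqF S0 /gt_eqF P0.
  by field; rewrite S0 P0.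
by rewrite -[leLHS]mulrDr.
Qed.

End ArcSandwich.

(** * Trigonometric polynomials in terms of sin(pi x) and cos(pi x) *)

Lemma size_polyM_le (R : nzRingType) (A B : {poly R}) a b :
  (size A <= a.+1)%N -> (size B <= b)%N ->
  (size (A * B)%R <= a + b)%N.
Proof.
move=> sA sB; apply: leq_trans (size_polyMleq _ _) _; move: sA sB.
by move: (size A) (size B) => x y; lia.
Qed.

Section TrigonometricPolynomials.
Variable R : realType.

Local Notation s x := (sin (x * pi)).
Local Notation c x := (cos (x * pi)).

Lemma expciD (a b : R) : expci (a + b) = expci a * expci b.
Proof.
rewrite /expci cosD sinD; apply/eqP; rewrite eq_complex /= eqxx /=.
by rewrite addrC eqxx.
Qed.

Lemma expciMn (a : R) k : expci (a * k%:R) = expci a ^+ k.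
Proof.
elim: k => [|k IH]; first by rewrite mulr0 /expci cos0 sin0 expr0.
by rewrite -natr1 mulrDr mulr1 expciD IH exprSr.
Qed.

Lemma expci_inv (a : R) : expci (- a) * expci a = 1.
Proof. by rewrite -expciD addNr /expci cos0 sin0. Qed.

Lemma fourier_monomial n (j : 'I_n) (x : R) :
  fourier j x = expci (- (2 * pi * x)) ^+ (n - 1)./2 * expci (2 * pi * x) ^+ j.
Proof.
rewrite /fourier -!expciMn -expciD; congr expci.
by rewrite rmorphB /= !pmulrn; ring.
Qed.

Lemma complex_natM k (y : R) : (k%:R * y)%:C = k%:R * y%:C.
Proof. by rewrite rmorphM; congr (_ * _); exact: (rmorph_nat (real_complex R)). Qed.

(** With z = exp(2 pi i x), this says sin(pi x)^2 = - (z - 1)^2 / (4 z). *)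
Lemma expci_sub1_sqr (x : R) :
  (expci (2 * pi * x) - 1) ^+ 2 = - (4 * s x ^+ 2)%:C * expci (2 * pi * x).
Proof.
have -> : 2 * pi * x = x * pi *+ 2 by rewrite -mulr_natr; ring.
rewrite /expci cos_mulr2n sin_mulr2n.
have := cos2Dsin2 (x * pi); move: (s x) (c x) => S C /eqP CS.
rewrite -subr_eq0 in CS; move/eqP in CS.
apply/eqP; rewrite eq_complex /=; apply/andP; split; rewrite -subr_eq0; apply/eqP.
  by transitivity (4 * (C ^+ 2 - 1) * (C ^+ 2 + S ^+ 2 - 1)); [ring|rewrite CS mulr0].
by transitivity (8 * C * S * (C ^+ 2 + S ^+ 2 - 1)); [ring|rewrite CS mulr0].
Qed.

(** With z = exp(2 pi i x), this says
    cos(pi x) sin(pi x) = (z^2 - 1) / (4 i z). *)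
Lemma expci_sqr_sub1 (x : R) :
  expci (2 * pi * x) ^+ 2 - 1 = 'i%C * (4 * (c x * s x))%:C * expci (2 * pi * x).
Proof.
have -> : 2 * pi * x = x * pi *+ 2 by rewrite -mulr_natr; ring.
rewrite /expci cos_mulr2n sin_mulr2n.
have := cos2Dsin2 (x * pi); move: (s x) (c x) => S C /eqP CS.
rewrite -subr_eq0 in CS; move/eqP in CS.
apply/eqP; rewrite eq_complex /=; apply/andP; split; rewrite -subr_eq0; apply/eqP.
  by transitivity (4 * C ^+ 2 * (C ^+ 2 + S ^+ 2 - 1)); [ring|rewrite CS mulr0].
by transitivity (0 * (C ^+ 2 + S ^+ 2 - 1)); [ring|rewrite CS mulr0].
Qed.

Lemma size_sinsqr_factor k :
  (size (((- 4^-1) *: ('X - 1) ^+ 2) ^+ k : {poly R[i]}) <= (2 * k).+1)%N.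
Proof.
apply: leq_trans (size_poly_exp_leq _ _) _; rewrite ltnS leq_mul2r.
apply/orP; right; have := size_scale_leq (- 4^-1 : R[i]) (('X - 1) ^+ 2).
rewrite -polyC1 size_exp_XsubC => h.
by rewrite -subn1 leq_subLR polyC1 in h *.
Qed.

(** The Chebyshev recursion, written for the double angle
    2 pi x with cos(2 pi x) = 1 - 2 sin(pi x)^2. *)
Lemma multiple_angle k : exists P Q : {poly R},
  [/\ (size P <= k.+1)%N, (size Q <= k)%N & forall x,
    cos (x * pi * (2 * k)%:R) = P.[s x ^+ 2] /\
    sin (x * pi * (2 * k)%:R) = c x * s x * Q.[s x ^+ 2]].
Proof.
elim: k => [|k [P [Q [sP sQ PQ]]]].
  exists 1, 0; split; rewrite ?size_poly1 ?size_poly0 // => x.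
  by rewrite muln0 mulr0 cos0 sin0 horner0 hornerC mulr0.
have s1 : (size (1 - 2 *: 'X : {poly R})%R <= 2)%N.
  apply: leq_trans (size_polyD _ _) _; rewrite size_poly1 size_polyN geq_max /=.
  by apply: leq_trans (size_scale_leq _ _) _; rewrite size_polyX.
have s2 : (size ((2 *: 'X) * (1 - 'X) : {poly R})%R <= 3)%N.
  apply: leq_trans (size_polyMleq _ _) _.
  rewrite -opprB size_polyN -polyC1 size_XsubC addn2 /= ltnS.
  by apply: leq_trans (size_scale_leq _ _) _; rewrite size_polyX.
exists (P * (1 - 2 *: 'X) - 2 *: 'X * (1 - 'X) * Q), (Q * (1 - 2 *: 'X) + 2 *: P).
split=> [||x].
- apply: leq_trans (size_polyD _ _) _; rewrite size_polyN geq_max.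
  by apply/andP; split; [rewrite -[k.+2]addn2|rewrite -[k.+2]add2n];
    rewrite size_polyM_le.
- apply: leq_trans (size_polyD _ _) _; rewrite geq_max mulrC.
  apply/andP; split; first by rewrite -[k.+1]add1n size_polyM_le.
  by rewrite (leq_trans (size_scale_leq _ _)).
have [cP sQx] := PQ x.
have -> : x * pi * (2 * k.+1)%:R = x * pi * (2 * k)%:R + (x * pi) *+ 2.
  by rewrite mulnS natrD mulrDr addrC [_ * 2]mulr_natr.
rewrite cosD (sinD (x * pi * (2 * k)%:R)) cP sQx.
rewrite cos_mulr2n sin_mulr2n cos2sin2 !hornerE.
have := cos2sin2 (x * pi); move: (s x) (c x) => S C CS.
move: P.[_] Q.[_] => p q /=; split; last by ring.
transitivity (p * (1 - 2 * S ^+ 2) - 2 * S ^+ 2 * C ^+ 2 * q); first by ring.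
by rewrite CS; ring.
Qed.

(** Polynomial form of a trigonometric polynomial, in which degrees are easy
    to track; [arc_poly_arc_fun] rescales it to [arc_fun]. *)
Definition arc_poly p q (f : R -> R) := exists P Q : {poly R},
  [/\ (size P <= p)%N, (size Q <= q)%N &
    forall x, f x = P.[s x ^+ 2] + c x * s x * Q.[s x ^+ 2]].

Lemma arc_poly_lincomb p q a b f g : arc_poly p q f -> arc_poly p q g ->
  arc_poly p q (fun x => a * f x + b * g x).
Proof.
move=> [P [Q [sP sQ fE]]] [P' [Q' [sP' sQ' gE]]].
have size_lincomb k (A B : {poly R}) : (size A <= k)%N -> (size B <= k)%N ->
    (size (a *: A + b *: B)%R <= k)%N.
  move=> sA sB; apply: leq_trans (size_polyD _ _) _; rewrite geq_max.
  by rewrite !(leq_trans (size_scale_leq _ _)).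
exists (a *: P + b *: P'), (a *: Q + b *: Q'); split; [exact: size_lincomb..|].
by move=> x; rewrite fE gE !hornerE; ring.
Qed.

Lemma arc_poly_sum p q n (a b : 'I_n -> R) (f g : 'I_n -> R -> R) :
  (forall i, arc_poly p q (f i)) -> (forall i, arc_poly p q (g i)) ->
  arc_poly p q (fun x => \sum_i (a i * f i x + b i * g i x)).
Proof.
move=> fP gP; elim: n a b f g fP gP => [|n IH] a b f g fP gP.
  exists 0, 0; rewrite !size_poly0; split=> // x.
  by rewrite big_ord0 !horner0 mulr0 addr0.
pose wd (i : 'I_n) := widen_ord (leqnSn n) i.
have /(arc_poly_lincomb 1 1) := IH (a \o wd) (b \o wd) (f \o wd) (g \o wd)
  (fun i => fP (wd i)) (fun i => gP (wd i)).
have := arc_poly_lincomb (a ord_max) (b ord_max) (fP ord_max) (gP ord_max).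
move=> last_poly /(_ _ last_poly) [P [Q [sP sQ PQ]]]; exists P, Q; split=> // x.
by rewrite -PQ big_ord_recr /= !mul1r.
Qed.

Lemma fourier_arc_poly n N (j : 'I_n) : n = (2 * N).+1 ->
  arc_poly N.+1 N (fun x => complex.Re (fourier j x)) /\
  arc_poly N.+1 N (fun x => complex.Im (fourier j x)).
Proof.
move=> nN; pose k := `|j%:Z - N%:Z|%N.
have kN : (k <= N)%N by rewrite /k; move: (ltn_ord j); lia.
(* The sign of the frequency. *)
pose e : R := if (N <= j)%N then 1 else -1.
have jE : (j%:Z - ((n - 1)./2)%:Z)%:~R = e * k%:R :> R.
  have -> : ((n - 1)./2 = N)%N by rewrite nN; lia.
  rewrite /e; case: ifP => Nj.
    have -> : j%:Z - N%:Z = k%:Z by rewrite /k; lia.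
    by rewrite mul1r.
  have -> : j%:Z - N%:Z = - k%:Z by rewrite /k; lia.
  by rewrite mulN1r rmorphN.
have [P [Q [sP sQ PQ]]] := multiple_angle k.
have ang (x : R) : 2 * pi * x * (e * k%:R) = e * (x * pi * (2 * k)%:R).
  by rewrite natrM; ring.
split.
  exists P, 0; rewrite size_poly0; split=> // [|x]; first exact: leq_trans sP _.
  rewrite /fourier /= jE ang horner0 mulr0 addr0 -(PQ x).1 /e.
  by case: ifP; rewrite ?mul1r // mulN1r cosN.
exists 0, (e *: Q); rewrite size_poly0; split=> // [|x].
  by apply: leq_trans (size_scale_leq _ _) _; exact: leq_trans sQ _.
rewrite /fourier /= jE ang horner0 add0r hornerZ [RHS]mulrCA -(PQ x).2 /e.
by case: ifP; rewrite ?mul1r // !mulN1r sinN.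
Qed.

End TrigonometricPolynomials.

Section FourierArc.
Variables (R : realType) (W : R).

Local Notation D := (`[- W, W]%classic).
Local Notation s x := (sin (x * pi)).
Local Notation c x := (cos (x * pi)).

(** With z = exp(2 pi i x), the frequencies -N, ..., N are the powers
    z^0, ..., z^(2N) divided by z^N. *)
Lemma poly_fspan_fourier n N (P : {poly R[i]}) (f : R -> R[i]) :
  n = (2 * N).+1 -> (size P <= n)%N ->
  (forall x, expci (2 * pi * x) ^+ N * f x = P.[expci (2 * pi * x)]) ->
  fspan D (@fourier R n) f.
Proof.
move=> nN sP fP; exists (fun j => P`_j) => x _.
have := fP x; rewrite (horner_coef_wide _ sP).
move/(congr1 (fun y => expci (- (2 * pi * x)) ^+ N * y)).
rewrite mulrA -exprMn expci_inv expr1n mul1r mulr_sumr => ->.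
have NE : ((n - 1)./2 = N)%N by rewrite nN; lia.
by apply: eq_bigr => j _; rewrite fourier_monomial NE; ring.
Qed.

Lemma even_monomial_fspan n N k : n = (2 * N).+1 -> (k <= N)%N ->
  fspan D (@fourier R n) (fun x => (s x ^+ (2 * k))%:C).
Proof.
move=> nN kN.
pose P : {poly R[i]} := 'X^(N - k) * ((- 4^-1) *: ('X - 1) ^+ 2) ^+ k.
apply: (@poly_fspan_fourier n N P) => // [|x].
  apply: leq_trans (size_polyMleq _ _) _; rewrite size_polyXn /=.
  by have := size_sinsqr_factor R k; move: (size _) => t; lia.
rewrite /P hornerM hornerXn horner_exp hornerZ horner_exp hornerD hornerN.
rewrite hornerX hornerC -[in LHS](subnK kN) exprD -mulrA; congr (_ * _).
rewrite expci_sub1_sqr exprM rmorphXn -exprMn; congr (_ ^+ k).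
by rewrite complex_natM !mulNr mulrN opprK !mulrA mulVf ?mul1r 1?mulrC.
Qed.

Lemma odd_monomial_fspan n N k : n = (2 * N).+1 -> (k < N)%N ->
  fspan D (@fourier R n) (fun x => (c x * s x ^+ (2 * k).+1)%:C).
Proof.
move=> nN kN.
pose A : {poly R[i]} := 'X^(N - k.+1).
pose B : {poly R[i]} := (4 * 'i%C)^-1 *: ('X ^+ 2 - 1).
pose C : {poly R[i]} := ((- 4^-1) *: ('X - 1) ^+ 2) ^+ k.
have sA : (size A <= (N - k.+1).+1)%N by rewrite size_polyXn.
have sB : (size B <= 3)%N.
  apply: leq_trans (size_scale_leq _ _) _; apply: leq_trans (size_polyD _ _) _.
  by rewrite size_polyXn size_polyN size_poly1.
have sC : (size C <= (2 * k).+1)%N by exact: (size_sinsqr_factor R k).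
apply: (@poly_fspan_fourier n N (A * B * C)) => // [|x].
  by have := size_polyMleq A B; have := size_polyMleq (A * B) C; lia.
rewrite 2!hornerM hornerXn horner_exp 2!hornerZ horner_exp 2!hornerD.
rewrite !hornerN hornerC hornerX horner_exp hornerX.
have z1 := expci_sub1_sqr x; have z2 := expci_sqr_sub1 x.
move: z1 z2; set z := expci _ => -> ->; rewrite !complex_natM.
rewrite -[in LHS](subnK kN) exprD -!mulrA; congr (_ * _).
transitivity ((c x * s x)%:C * z * (z * (s x ^+ 2)%:C) ^+ k).
  rewrite [s x ^+ _]exprS exprM [(z * _) ^+ _]exprMn -(rmorphXn (real_complex R)).
  by rewrite mulrA rmorphM exprS; ring.
have i0 : 'i%C != 0 :> R[i] by rewrite eq_complex /= oner_eq0 andbF.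
rewrite !mulrA -[(4 * 'i%C)^-1 * _ * 4]mulrA ['i%C * 4]mulrC mulVf; last first.
  by rewrite mulf_neq0 // pnatr_eq0.
rewrite mul1r; congr (_ * _ * _ ^+ k).
by rewrite mulrNN [4^-1 * _]mulrA mulVf ?mul1r 1?mulrC // pnatr_eq0.
Qed.

Lemma fspan_sum n (v : 'I_n -> R -> R[i]) (I : finType) (a : I -> R[i])
    (f : I -> R -> R[i]) :
  (forall i, fspan D v (f i)) -> fspan D v (fun x => \sum_i a i * f i x).
Proof.
move=> fv; have [b fb] := choice fv.
exists (fun j => \sum_i a i * b i j) => x Dx.
under eq_bigr => i _ do rewrite (fb i x Dx) mulr_sumr.
rewrite exchange_big; apply: eq_bigr => j _ /=.
by rewrite mulr_suml; apply: eq_bigr => i _; rewrite mulrA.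
Qed.

Lemma fspanD n (v : 'I_n -> R -> R[i]) (f g : R -> R[i]) :
  fspan D v f -> fspan D v g -> fspan D v (fun x => f x + g x).
Proof.
move=> [a fa] [b gb]; exists (fun j => a j + b j) => x Dx.
by rewrite fa // gb // -big_split; apply: eq_bigr => j _; rewrite mulrDl.
Qed.

(** The monomials s^(2i) with i <= N and c s^(2k+1) with k < N all have
    degree at most N, and here k = m + i with i < N - m. *)
Lemma arc_fun_fspan n N m (v : 'I_N.+1 -> R) (w : 'I_(N - m) -> R) :
  n = (2 * N).+1 ->
  fspan D (@fourier R n) (fun x => (arc_fun W 0 (2 * m + 1)%N v w x)%:C).
Proof.
move=> nN.
rewrite (_ : (fun x => _) = fun x =>
    \sum_i (v i / s W ^+ (2 * i))%:C * (s x ^+ (2 * i))%:C +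
    \sum_i (w i / s W ^+ (2 * (m + i)).+1)%:C * (c x * s x ^+ (2 * (m + i)).+1)%:C).
  apply: fspanD; apply: fspan_sum => i.
    by apply: (@even_monomial_fspan n N); rewrite // -ltnS.
  by apply: (@odd_monomial_fspan n N) => //; move: (ltn_ord i); lia.
apply/funext => x; rewrite /arc_fun rmorphD; congr (_ + _).
  rewrite rmorph_sum; apply: eq_bigr => i _.
  by rewrite -rmorphM /arith_step addn0 expr_div_n mulrAC mulrA.
rewrite mulr_sumr rmorph_sum; apply: eq_bigr => i _.
rewrite -rmorphM /arith_step (_ : 2 * i + _ = (2 * (m + i)).+1)%N; last by lia.
by rewrite expr_div_n; congr (_%:C); ring.
Qed.

Hypotheses (W_gt0 : 0 < W) (W_lt : W < 1 / 2).

Lemma arc_poly_arc_fun p q f : arc_poly p q f ->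
  exists (v : 'I_p -> R) (w : 'I_q -> R), f = arc_fun W 0 1 v w.
Proof.
move=> [P [Q [sP sQ fE]]].
have sW : s W != 0 by rewrite gt_eqF // sinW_gt0.
exists (fun i => P`_i * s W ^+ (2 * i)), (fun i => Q`_i * s W ^+ (2 * i).+1).
apply/funext => x; rewrite /arc_fun /muntz_fun fE.
rewrite (horner_coef_wide _ sP) (horner_coef_wide _ sQ).
congr (_ + _).
  apply: eq_bigr => i _; rewrite /arith_step addn0 expr_div_n -exprM.
  by rewrite mulrACA mulfV ?mulr1 // expf_neq0.
rewrite -mulrA; congr (_ * _); rewrite mulr_sumr.
apply: eq_bigr => i _; rewrite /arith_step addn1 expr_div_n -exprM.
rewrite [in RHS]mulrACA mulfV ?mulr1 ?expf_neq0 //.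
by rewrite exprS; ring.
Qed.

Lemma fspan_fourier_arc_fun n N (f : R -> R[i]) : n = (2 * N).+1 ->
  fspan D (@fourier R n) f ->
  exists (g h : R -> R), [/\ forall x, D x -> f x = g x +i* h x,
    exists (v : 'I_N.+1 -> R) (w : 'I_N -> R), g = arc_fun W 0 1 v w &
    exists (v : 'I_N.+1 -> R) (w : 'I_N -> R), h = arc_fun W 0 1 v w].
Proof.
move=> nN [a fE].
have FP j := fourier_arc_poly R j nN.
have gP := arc_poly_sum (fun j => complex.Re (a j)) (fun j => - complex.Im (a j))
  (fun j => (FP j).1) (fun j => (FP j).2).
have hP := arc_poly_sum (fun j => complex.Im (a j)) (fun j => complex.Re (a j))
  (fun j => (FP j).1) (fun j => (FP j).2).
exists (fun x => complex.Re (\sum_j a j * fourier j x)).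
exists (fun x => complex.Im (\sum_j a j * fourier j x)); split.
- by move=> x Dx; rewrite fE //; case: (\sum_(_ < _) _).
- have [v [w E]] := arc_poly_arc_fun gP; exists v, w; rewrite -E.
  apply/funext => x; rewrite (raddf_sum (@complex.Re R)); apply: eq_bigr => j _.
  by case: (a j) (fourier j x) => [ar ai] [fr fi] /=; rewrite mulNr.
- have [v [w E]] := arc_poly_arc_fun hP; exists v, w; rewrite -E.
  apply/funext => x; rewrite (raddf_sum (@complex.Im R)); apply: eq_bigr => j _.
  by case: (a j) (fourier j x) => [ar ai] [fr fi] /=; rewrite addrC.
Qed.

End FourierArc.

(** * Orthonormal bases and the extremal property of the Christoffel function *)

Section ComplexCauchySchwarz.
Variable R : realType.

Definition normsq (z : R[i]) : R := complex.Re z ^+ 2 + complex.Im z ^+ 2.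

Lemma normsq_ge0 z : 0 <= normsq z.
Proof. by rewrite addr_ge0 ?sqr_ge0. Qed.

Lemma normsqE z : ComplexField.Normc.normc z ^+ 2 = normsq z.
Proof. by case: z => a b; rewrite /= sqr_sqrtr // addr_ge0 ?sqr_ge0. Qed.

Lemma normsq_conj z : normsq z^*%C = normsq z.
Proof. by case: z => a b; rewrite /normsq /= sqrrN. Qed.

Lemma mul_conj_normsq z : z * z^*%C = (normsq z)%:C.
Proof.
case: z => a b; rewrite /normsq /=; apply/eqP; rewrite eq_complex /=.
by apply/andP; split; apply/eqP; ring.
Qed.

Lemma normsq_Re z : normsq z = complex.Re (z * z^*%C).
Proof. by rewrite mul_conj_normsq. Qed.

(** Expand sum_i |k a_i - t conj(z_i)|^2 >= 0, where t = sum_i a_i z_i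
    and k = sum_i |z_i|^2. *)
Lemma complex_cauchy_schwarz (I : finType) (a z : I -> R[i]) :
  normsq (\sum_i a i * z i) <= (\sum_i normsq (a i)) * (\sum_i normsq (z i)).
Proof.
set t := \sum_i _; set A := \sum_i _; set k := \sum_i _.
have k0 : 0 <= k by apply: sumr_ge0 => i _; exact: normsq_ge0.
have [kz|knz] := eqVneq k 0.
  rewrite kz mulr0 /t big1 ?/normsq /= ?expr0n ?addr0 // => i _.
  have /eqP := kz; rewrite psumr_eq0 => [/allP/(_ i)|j _]; last exact: normsq_ge0.
  rewrite mem_index_enum /normsq => /(_ isT).
  rewrite paddr_eq0 ?sqr_ge0 // !sqrf_eq0 => /andP[/eqP zr /eqP zi].
  have -> : z i = 0 by apply/eqP; rewrite eq_complex zr zi eqxx.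
  by rewrite mulr0.
have kgt0 : 0 < k by rewrite lt_neqAle eq_sym knz.
have : 0 <= \sum_i normsq (k%:C * a i - t * (z i)^*%C).
  by apply: sumr_ge0 => i _; exact: normsq_ge0.
have -> : \sum_i normsq (k%:C * a i - t * (z i)^*%C) =
    k ^+ 2 * A - 2 * k * complex.Re (t^*%C * t) + normsq t * k.
  have expand i : normsq (k%:C * a i - t * (z i)^*%C) = k ^+ 2 * normsq (a i) -
      2 * k * complex.Re (t^*%C * (a i * z i)) + normsq t * normsq (z i).
    by rewrite /normsq; case: (a i) (z i) t => [ar ai] [zr zi] [tr ti] /=; ring.
  under eq_bigr do rewrite expand.
  rewrite big_split sumrB -!mulr_sumr -(raddf_sum (@complex.Re R)).
  by rewrite -mulr_sumr.
rewrite [t^*%C * t]mulrC -normsq_Re.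
rewrite (_ : _ + _ = k * (A * k - normsq t)); last by ring.
by rewrite pmulr_rge0 // subr_ge0.
Qed.

End ComplexCauchySchwarz.

Section OrthonormalBasis.
Variables (R : realType) (W : R).

Local Notation mu := (@lebesgue_measure R).
Local Notation D := (`[- W, W]%classic).

(** Elements of a span are only determined on the interval, so
    continuity is asked of representatives p and q of the two parts. *)
Definition continuous_parts (p q : R -> R) (f : R -> R[i]) : Prop :=
  [/\ continuous p, continuous q & forall x, D x -> f x = p x +i* q x].

(** The integrals available are real, so the double sum of
    a_j conj(a_k) u_j conj(u_k) is split into products of real parts (P) and products
    of imaginary parts (Q) before integrating. *)
Lemma parseval n (u : 'I_n -> R -> R[i]) (p q : 'I_n -> R -> R) (a : 'I_n -> R[i]) :
  (forall i, continuous_parts (p i) (q i) (u i)) ->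
  (forall i j, inner D (u i) (u j) = (i == j)%:R) ->
  \int[mu]_(x in D) normsq (\sum_i a i * u i x) = \sum_i normsq (a i).
Proof.
move=> pq orth.
have cp i : continuous (p i) by case: (pq i).
have cq i : continuous (q i) by case: (pq i).
have ue i x : D x -> u i x = p i x +i* q i x by case: (pq i) => _ _; apply.
pose P (jk : 'I_n * 'I_n) x := p jk.1 x * p jk.2 x + q jk.1 x * q jk.2 x.
pose Q (jk : 'I_n * 'I_n) x := q jk.1 x * p jk.2 x + (- 1) * (p jk.1 x * q jk.2 x).
pose A (jk : 'I_n * 'I_n) := complex.Re (a jk.1 * (a jk.2)^*%C).
pose B (jk : 'I_n * 'I_n) := - complex.Im (a jk.1 * (a jk.2)^*%C).
have cP jk : continuous (P jk).
  by apply: continuous_add; exact: continuous_mul.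
have cQ jk : continuous (Q jk).
  apply: continuous_add; first exact: continuous_mul.
  by apply: continuous_mul; [exact: cst_continuous|exact: continuous_mul].
have intP j k : \int[mu]_(x in D) P (j, k) x = (j == k)%:R.
  have := congr1 (@complex.Re R) (orth j k); rewrite /inner /cintegral /=.
  have -> : complex.Re ((j == k)%:R : R[i]) = (j == k)%:R by case: eqP.
  move=> <-; apply: eq_Rintegral => x /set_mem Dx.
  by rewrite !ue // /P /=; ring.
have intQ j k : \int[mu]_(x in D) Q (j, k) x = 0.
  have := congr1 (@complex.Im R) (orth j k); rewrite /inner /cintegral /=.
  have -> : complex.Im ((j == k)%:R : R[i]) = 0 by case: eqP.
  move=> <-; apply: eq_Rintegral => x /set_mem Dx.
  by rewrite !ue // /Q /=; ring.
transitivity (\int[mu]_(x in D) (\sum_jk A jk * P jk x + \sum_jk B jk * Q jk x)).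
  apply: eq_Rintegral => x /set_mem Dx.
  rewrite normsq_Re rmorph_sum big_distrlr /= (raddf_sum (@complex.Re R)).
  rewrite -big_split.
  rewrite -(pair_bigA _ (fun j k => A (j, k) * P (j, k) x + B (j, k) * Q (j, k) x)) /=.
  apply: eq_bigr => j _; rewrite (raddf_sum (@complex.Re R)); apply: eq_bigr => k _.
  rewrite !ue // /A /B /P /Q /=.
  by case: (a j) (a k) => [ar ai] [br bi] /=; ring.
have cAP (F : 'I_n * 'I_n -> R) (f : 'I_n * 'I_n -> R -> R) :
    (forall jk, continuous (f jk)) -> continuous (fun x => \sum_jk F jk * f jk x).
  move=> cf; apply: continuous_sum => jk; apply: continuous_mul => //.
  exact: cst_continuous.
rewrite RintegralD //; last 2 first.
- exact/continuous_integrable/cAP.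
- exact/continuous_integrable/cAP.
rewrite !Rintegral_sum // [X in _ + X]big1 ?addr0 => [|[j k] _]; last first.
  by rewrite intQ mulr0.
rewrite -(pair_bigA _ (fun j k => A (j, k) * \int[mu]_(x in D) P (j, k) x)) /=.
apply: eq_bigr => j _; rewrite (bigD1 j) //= big1 ?addr0 => [|k kj].
  by rewrite intP eqxx mulr1 /A /= -normsq_Re.
by rewrite intP eq_sym (negbTE kj) mulr0.
Qed.

(** The kernel f = sum_i conj(u_i(y)) u_i satisfies f(y) = k(y) = ||f||^2,
    so the assumed inequality for it reads k(y)^2 <= C k(y). *)
Lemma christoffel_le n (v u : 'I_n -> R -> R[i]) (p q : 'I_n -> R -> R)
    (y C : R) :
  (forall i, continuous_parts (p i) (q i) (u i)) ->
  orthonormal_basis D (fspan D v) u ->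
  0 <= C ->
  (forall f, fspan D v f -> normsq (f y) <= C * \int[mu]_(x in D) normsq (f x)) ->
  inv_christoffel u y <= C.
Proof.
move=> pq [orth span] C0 fC; rewrite /inv_christoffel.
under eq_bigr do rewrite normsqE.
set k := \sum_i _.
have k0 : 0 <= k by apply: sumr_ge0 => i _; exact: normsq_ge0.
pose f x := \sum_i (u i y)^*%C * u i x.
have fv : fspan D v f by rewrite -span; exists (fun i => (u i y)^*%C).
have := fC f fv; rewrite /f (parseval _ pq orth).
under [X in C * X]eq_bigr do rewrite normsq_conj.
have -> : \sum_i (u i y)^*%C * u i y = k%:C.
  rewrite rmorph_sum; apply: eq_bigr => i _ /=.
  by rewrite mulrC mul_conj_normsq.
rewrite /normsq /= expr0n addr0 -/k expr2.
move: k0; rewrite le_eqVlt => /orP[/eqP <- //|k0].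
by rewrite ler_pM2r.
Qed.

Lemma christoffel_ge n (v u : 'I_n -> R -> R[i]) (p q : 'I_n -> R -> R)
    (y : R) (f : R -> R[i]) :
  (forall i, continuous_parts (p i) (q i) (u i)) ->
  orthonormal_basis D (fspan D v) u -> fspan D v f -> D y ->
  normsq (f y) <= inv_christoffel u y * \int[mu]_(x in D) normsq (f x).
Proof.
move=> pq [orth span]; rewrite -span => -[a fa] Dy.
under eq_Rintegral => x /set_mem Dx do rewrite fa //.
rewrite (parseval _ pq orth) fa // mulrC /inv_christoffel.
under [X in _ <= _ * X]eq_bigr do rewrite normsqE.
exact: complex_cauchy_schwarz.
Qed.

End OrthonormalBasis.

(** * Two-sided bounds at the endpoint *)

Section ArcChristoffel.
Variables (R : realType) (W : R).
Hypotheses (W_gt0 : 0 < W) (W_lt : W < 1 / 2).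

Local Notation mu := (@lebesgue_measure R).
Local Notation D := (`[- W, W]%classic).
Local Notation s x := (sin (x * pi)).
Local Notation c x := (cos (x * pi)).
Local Notation kappa := (endpoint_rate W).
Local Notation tr r p := (muntz_trace R (@arith_step r p)).

Lemma fourier_basis_parts n N (u : 'I_n -> R -> R[i]) : n = (2 * N).+1 ->
  orthonormal_basis D (fspan D (@fourier R n)) u ->
  exists (p q : 'I_n -> R -> R), forall i, continuous_parts W (p i) (q i) (u i).
Proof.
move=> nN [_ span].
have : forall i, exists pq : (R -> R) * (R -> R),
    continuous_parts W pq.1 pq.2 (u i).
  move=> i; have ui : fspan D (@fourier R n) (u i).
    rewrite -span; exists (fun j => (j == i)%:R) => x _.
    rewrite (bigD1 i) //= eqxx mul1r big1 ?addr0 // => j ji.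
    by rewrite (negbTE ji) mul0r.
  have [g [h [gh [v [w gE]] [v' [w' hE]]]]] :=
    fspan_fourier_arc_fun W_gt0 W_lt nN ui.
  by exists (g, h); split=> //=; rewrite ?gE ?hE; exact: continuous_arc_fun.
move=> /choice[pq pqP]; exists (fun i => (pq i).1), (fun i => (pq i).2).
exact: pqP.
Qed.

Lemma endW_mem : D W.
Proof. by rewrite /= in_itv /= lexx andbT ge0_cp // ltW. Qed.

(** The endpoint inequality for real functions applies to the real
    and to the imaginary part of an element of the span, and the squares add up. *)
Lemma christoffel_upper m n N (u : 'I_n -> R -> R[i]) : n = (2 * N).+1 ->
  (forall x, D x -> (s x / s W) ^+ (4 * m) * c x <= c W) ->
  orthonormal_basis D (fspan D (@fourier R n)) u ->
  inv_christoffel u W <= kappa * (tr (2 * m)%N N.+1 + tr 1%N N).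
Proof.
move=> nN peak ub; have [p [q pq]] := fourier_basis_parts nN ub.
apply: (christoffel_le pq ub) => [|f fv].
  rewrite mulr_ge0 ?addr_ge0 ?muntz_trace_ge0 // ltW //.
  exact: endpoint_rate_gt0.
have [g [h [gh [v [w gE]] [v' [w' hE]]]]] :=
  fspan_fourier_arc_fun W_gt0 W_lt nN fv.
have cg : continuous g by rewrite gE; exact: continuous_arc_fun.
have ch : continuous h by rewrite hE; exact: continuous_arc_fun.
under eq_Rintegral => x /set_mem Dx do rewrite (gh x Dx) /normsq /=.
rewrite RintegralD //; last 2 first.
- by apply: continuous_integrable; exact: continuousX.
- by apply: continuous_integrable; exact: continuousX.
rewrite (gh _ endW_mem) /normsq /= mulrDr.
by apply: lerD; rewrite ?gE ?hE; exact: arc_fun_end_le.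
Qed.

(** For the test function f of [arc_fun_extremal], f(W) = S and
    kappa ||f||^2 <= S, whence S^2 <= k(W) ||f||^2 <= k(W) S / kappa. *)
Lemma christoffel_lower m n N (u : 'I_n -> R -> R[i]) : n = (2 * N).+1 ->
  (forall x, D x -> (s x / s W) ^+ (4 * m) * c x <= c W) ->
  orthonormal_basis D (fspan D (@fourier R n)) u ->
  kappa * (tr 0%N N.+1 + tr 1%N (N - m)%N) <= inv_christoffel u W.
Proof.
move=> nN peak ub; have [p [q pq]] := fourier_basis_parts nN ub.
have [v [w [fW fint]]] := arc_fun_extremal W_gt0 W_lt N.+1 (N - m)%N peak.
have k0 : 0 < kappa by exact: endpoint_rate_gt0.
set S := tr 0%N N.+1 + _ in fW fint *.
have S0 : 0 < S.
  apply: ltr_pwDl; last exact: muntz_trace_ge0.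
  rewrite arith_step_trace -[N.+1%:R]natr1.
  have := ler0n R N; move: (N%:R) => y y0.
  by apply: mulr_gt0; lra.
have := christoffel_ge pq ub (arc_fun_fspan W v w nN) endW_mem.
rewrite fW.
under eq_Rintegral do rewrite /normsq /= expr0n addr0.
rewrite /normsq /= expr0n addr0 => h.
have K0 : 0 <= inv_christoffel u W.
  by apply: sumr_ge0 => i _; exact: sqr_ge0.
rewrite -(ler_pM2r S0) -mulrA -expr2.
apply: le_trans (_ : kappa * (inv_christoffel u W *
    \int[mu]_(x in D) (arc_fun W 0%N (2 * m + 1)%N v w x ^+ 2)) <= _).
  by rewrite ler_pM2l.
by rewrite mulrCA; apply: ler_wpM2l.
Qed.

(** Both bounds differ from kappa n^2 by at most 4 m kappa n; when
    N < m the truncated N - m makes the odd part of the lower bound vanish, but then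
    N itself is smaller than m. *)
Lemma christoffel_relative_error m n N (u : 'I_n -> R -> R[i]) : n = (2 * N).+1 ->
  (forall x, D x -> (s x / s W) ^+ (4 * m) * c x <= c W) ->
  orthonormal_basis D (fspan D (@fourier R n)) u ->
  `|inv_christoffel u W / (n%:R ^+ 2 * (pi / 2) * cot (W * pi)) - 1|
    <= (4 * m)%:R / n%:R.
Proof.
move=> nN peak ub.
have up := christoffel_upper nN peak ub; have lo := christoffel_lower nN peak ub.
have k0 : 0 < kappa by exact: endpoint_rate_gt0.
have -> : n%:R ^+ 2 * (pi / 2) * cot (W * pi) = kappa * n%:R ^+ 2.
  by rewrite /endpoint_rate /cot invfM; ring.
have n0 : 0 < n%:R :> R by rewrite ltr0n nN.
have kn0 : 0 < kappa * n%:R ^+ 2 by rewrite mulr_gt0 ?exprn_gt0.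
have nE : n%:R = 2 * N%:R + 1 :> R by rewrite nN -natr1 natrM.
have N0 := ler0n R N; have m0 := ler0n R m.
rewrite -[X in `|_ - X|](mulfV (lt0r_neq0 kn0)) -mulrBl normrM normfV.
rewrite (gtr0_norm kn0) ler_pdivrMr //.
have -> : (4 * m)%:R / n%:R * (kappa * n%:R ^+ 2) = kappa * (4 * m%:R * n%:R) :> R.
  rewrite natrM; move: (lt0r_neq0 n0) => n0'; move: kappa (n%:R : R) n0' => k y y0.
  by field.
have L_ge : n%:R ^+ 2 - 4 * m%:R * n%:R <= tr 0%N N.+1 + tr 1%N (N - m)%N :> R.
  rewrite !arith_step_trace nE -[N.+1%:R]natr1; have [mN|Nm] := leqP m N.
    rewrite natrB //; have : m%:R <= N%:R :> R by rewrite ler_nat.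
    move: (m%:R) (N%:R) m0 N0 => y z y0 z0 yz.
    by have := mulr_ge0 y0 z0; have := sqr_ge0 y; rewrite mulr0n; nra.
  have /eqP -> : (N - m == 0)%N by rewrite subn_eq0 ltnW.
  have : N%:R <= m%:R :> R by rewrite ler_nat ltnW.
  move: (m%:R) (N%:R) m0 N0 => y z y0 z0 yz.
  have := mulr_ge0 z0 (_ : 0 <= y - z); rewrite subr_ge0 => /(_ yz).
  by rewrite mulr0n; nra.
have U_le : tr (2 * m)%N N.+1 + tr 1%N N <= n%:R ^+ 2 + 4 * m%:R * n%:R :> R.
  rewrite !arith_step_trace nE -[N.+1%:R]natr1 natrM.
  move: (m%:R) (N%:R) m0 N0 => y z y0 z0.
  by have := mulr_ge0 y0 z0; nra.
rewrite ler_norml -(ler_pM2l k0) in L_ge *; rewrite -(ler_pM2l k0) in U_le.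
have := le_trans L_ge lo; have := le_trans up U_le.
move: (inv_christoffel u W) kappa (n%:R : R) (m%:R : R) => K k y z h1 h2.
by apply/andP; split; lra.
Qed.

End ArcChristoffel.

Theorem theorem35 (R : realType) (W : R) (W_gt0 : 0 < W) (W_lt : W < 1 / 2)
    (u : forall n : nat, 'I_n -> R -> R[i])
    (u_basis : forall n : nat, odd n ->
      orthonormal_basis `[- W, W] (fspan `[- W, W] (@fourier R n)) (u n)) :
  (forall n : nat, odd n ->
    ((inv_christoffel (u n) W)%:E
       <= (sup_norm `[- W, W] (inv_christoffel (u n)))%R)%E) /\
  (inv_christoffel (u n) W / (n%:R ^+ 2 * (pi / 2) * cot (W * pi))
     @[n --> within [set n : nat | odd n] \oo] --> (1 : R)).
Proof.
split=> [n _|].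
  apply: ereal_sup_ubound; exists W; first exact: endW_mem.
  by rewrite ger0_norm // sumr_ge0 // => i _; exact: sqr_ge0.
have [m peak] := sin_ratio_peak W_gt0 W_lt.
apply/cvgrPdist_le => e e0; rewrite near_withinE.
near=> n => /= on.
have nN : n = (2 * n./2).+1 by rewrite -[LHS]odd_double_half on add1n mul2n.
rewrite distrC.
apply: le_trans (christoffel_relative_error W_gt0 W_lt nN peak (u_basis n on)) _.
rewrite ler_pdivrMr ?ltr0n ?odd_gt0 // -ler_pdivrMl //.
near: n; exact: nbhs_infty_ger.
Unshelve. all: by end_near.
Qed.
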